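(* Let $(G,S)$ be an indecomposable Coxeter system with $S$ finite and $G$ infinite. If the associated canonical bilinear form $B$ is indefinite and non-degenerate, then $G$ is an icc-group, i.e. the conjugacy class of every element of $G$ different from the identity is infinite.
   Context: For a Coxeter system $(G,S)$ let $m(s,t)$ denote the order of $st$ in $G$ ($s,t\in S$). The canonical bilinear form is the symmetric bilinear form $B$ on $E=\bigoplus_{s\in S}\mathbb{R}e_s$ with $B(e_s,e_s)=1$, $B(e_s,e_t)=-\cos(\pi/m(s,t))$ if $s\neq t$ and $m(s,t)<\infty$, and $B(e_s,e_t)=-1$ if $m(s,t)=\infty$. The form $B$ is indefinite if it takes both positive and negative values $B(x,x)$, and non-degenerate if no non-zero $x\in E$ satisfies $B(x,y)=0$ for all $y\in E$. The system $(G,S)$ is decomposable if $S$ is the disjoint union of two non-empty subsets $S_1,S_2$ such that every $s\in S_1$ commutes with every $t\in S_2$ (equivalently $B(e_s,e_t)=0$ for such $s,t$), and indecomposable otherwise. *)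

(* Defs.v *)
From HB Require Import structures.
From mathcomp Require Import all_boot all_order all_algebra.
From mathcomp Require Import finmap.
From mathcomp Require Import all_classical all_reals all_analysis.

Set Implicit Arguments.
Unset Strict Implicit.
Unset Printing Implicit Defensive.

Import Order.TTheory GRing.Theory Num.Theory.

Local Open Scope classical_set_scope.

(* [gorder x] is the order of x, with the convention that 0 stands for
   infinite order. *)
Definition gorder (G : groupType) (x : G) : nat :=
  if pselect (exists n : nat, (0 < n)%N && (x ^+ n == 1)%g) is left h
  then ex_minn h else 0%N.

Definition coxeter_m (G : groupType) (s t : G) : nat := gorder (s * t)%g.

Definition is_subgroup (G : groupType) (H : set G) : Prop :=
  [/\ H 1%g,
      forall x y, H x -> H y -> H (x * y)%g
    & forall x, H x -> H (x^-1)%g].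

Definition generates (G : groupType) (S : set G) : Prop :=
  forall H : set G, is_subgroup H -> S `<=` H -> H = setT.

(* The last clause, together with generation, says that S and the relations
   (s t)^m(s,t) = 1, for m(s,t) finite, form a presentation of G: it is the
   universal property of the group so presented.  Only the values on S of
   f : G -> H matter. *)
Definition coxeter_system (G : groupType) (S : set G) : Prop :=
  [/\ forall s, S s -> gorder s = 2%N,
      generates S
    & forall (H : groupType) (f : G -> H),
        (forall s t, S s -> S t -> coxeter_m s t <> 0%N ->
           (f s * f t) ^+ coxeter_m s t = 1)%g ->
        exists phi : {multiplicative G -> H}, forall s, S s -> phi s = f s].

Definition decomposable (G : groupType) (S : set G) : Prop :=
  exists S1 S2 : set G,
    [/\ S1 `|` S2 = S, S1 `&` S2 = set0, S1 !=set0, S2 !=set0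
      & forall s t, S1 s -> S2 t -> commute s t].

Definition indecomposable (G : groupType) (S : set G) : Prop :=
  ~ decomposable S.

Local Open Scope ring_scope.

Definition canonical_coef (R : realType) (G : groupType) (s t : G) : R :=
  if s == t then 1
  else if coxeter_m s t == 0%N then -1
  else - cos (pi / (coxeter_m s t)%:R).

(* E is realized as {ffun S -> R}, with e_s the indicator function of s. *)
Definition canonical_form (R : realType) (G : groupType) (S : {fset G})
    (x y : {ffun S -> R}) : R :=
  \sum_(s : S) \sum_(t : S) x s * y t * canonical_coef R (val s) (val t).

Definition indefinite_form (E : Type) (R : realType) (B : E -> E -> R) : Prop :=
  (exists x, 0 < B x x) /\ (exists x, B x x < 0).

Definition nondegenerate_form (E : zmodType) (R : realType) (B : E -> E -> R) :
    Prop :=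
  forall x, (forall y, B x y = 0) -> x = 0.

Definition conjugacy_class (G : groupType) (g : G) : set G :=
  [set (g ^ h)%g | h in [set: G]].

Definition icc (G : groupType) : Prop :=
  forall g : G, g <> 1%g -> infinite_set (conjugacy_class g).

(* Main.v *)
Require Import Defs.
From HB Require Import structures.
From mathcomp Require Import all_boot all_order all_algebra.
From mathcomp Require Import finmap.
From mathcomp Require Import all_classical all_reals all_analysis.
From mathcomp Require Import ring lra.

(** The proof uses the canonical reflection representation of G on E, in which
s acts by the reflection x |-> x - 2 B(e_s, x) e_s.  A root is a vector w e_s
with w in G; every root b satisfies B(b, b) = 1 and its reflection r_b is the
action of an element of G.

Let g have a finite conjugacy class.  For every h in G two of the conjugates of
g by powers of h coincide, so g commutes with some power h^n, n > 0
([fc_commute_expg]).  Apply this to h = r_a r_b, where a and b are roots with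
|B(a, b)| > 1.  On the plane P spanned by a and b the isometry h is hyperbolic:
h^n + h^-n is there the multiplication by a scalar T_n > 2, while h^n - 1 sends
all of E into P.  As g commutes with h^n, the vector
(T_n - 2) g a = (h^n + h^-n - 2) g a lies in P, so that g a lies in P
([fc_plane]).

If two planes P as above contain a = e_s and are distinct, they intersect in a
line, so g e_s is a multiple of e_s, hence e_s or - e_s since g is an isometry
([fc_simple_root]).  There are two such planes:
- The numbers B(e_s, b), for b a root, are unbounded for every s
  ([roots_unbounded]).  Boundedness for s forces boundedness for every t with
  B(e_s, e_t) <> 0, hence, by indecomposability, for all t; by non-degeneracy
  the coordinates of all roots are then bounded.  But only the identity is close
  to the identity in the representation, so a bounded G would be finite
  ([bounded_roots_finite]).
- Given one plane P spanned by e_s and b, take u <> s with B(e_s, e_u) <> 0.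
  The form is positive semidefinite on the span of e_s and e_u, which excludes
  that e_u is in P; and the vectors h^n e_u, for h = r_(e_s) r_b and n an
  integer, stay outside P while B(e_s, h^n e_u) escapes from [-1, 1]
  ([hyperbolic_partner]).

The signs of the g e_s agree for neighbours s and t, hence for all s, so that g
acts as 1 or as -1.  It remains to use that, by the positivity theorem of Tits
([act_simple_root_nonneg]), w e_s has nonnegative coordinates when w s is not
shorter than w, and nonpositive coordinates otherwise.  An element other than 1
makes some e_s negative, so the representation is faithful, and even discrete
([act_diag_gt0]).  If g acted as -1, multiplication by g would reverse the order
of lengths, l(g w) + l(w) <= l(g), which bounds all lengths and makes G finite
([len_opposition]). *)

Set Implicit Arguments.
Unset Strict Implicit.
Unset Printing Implicit Defensive.

Import Order.TTheory GRing.Theory Num.Theory.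

Local Open Scope classical_set_scope.
Local Open Scope ring_scope.

(** * A symmetric form with a Gram matrix, and its reflections *)

Section BilinearForm.
Variables (R : realFieldType) (I : finType) (c : I -> I -> R).
Hypothesis cC : forall s t, c s t = c t s.

Local Notation E := {ffun I -> R^o}.

Definition bform (x y : E) : R := \sum_s \sum_t x s * y t * c s t.

Definition simple_root (s : I) : E := [ffun t => (t == s)%:R].

Definition refl (a x : E) : E := x - (2 * bform a x) *: a.

Lemma bformC x y : bform x y = bform y x.
Proof.
rewrite /bform exchange_big; apply: eq_bigr => s _; apply: eq_bigr => t _.
by rewrite cC; ring.
Qed.

Lemma bformD x y z : bform x (y + z) = bform x y + bform x z.
Proof.
rewrite /bform -big_split; apply: eq_bigr => s _ /=.
by rewrite -big_split; apply: eq_bigr => t _ /=; rewrite ffunE; ring.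
Qed.

Lemma bformZ x k y : bform x (k *: y) = k * bform x y.
Proof.
rewrite /bform mulr_sumr; apply: eq_bigr => s _ /=.
rewrite mulr_sumr; apply: eq_bigr => t _ /=.
by rewrite ffunE /GRing.scale/=; ring.
Qed.

Lemma bformN x y : bform x (- y) = - bform x y.
Proof. by rewrite -scaleN1r bformZ mulN1r. Qed.

Lemma bformDl x y z : bform (x + y) z = bform x z + bform y z.
Proof. by rewrite !(bformC _ z) bformD. Qed.

Lemma bformZl k x y : bform (k *: x) y = k * bform x y.
Proof. by rewrite !(bformC _ y) bformZ. Qed.

Lemma bformNl x y : bform (- x) y = - bform x y.
Proof. by rewrite !(bformC _ y) bformN. Qed.

Definition bformE :=
  (bformD, bformN, bformZ, bformDl, bformNl, bformZl).

Lemma simple_root_sum (x : E) : x = \sum_s x s *: simple_root s.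
Proof.
apply/ffunP => t; rewrite sum_ffunE (bigD1 t)//= big1 => [|s /negbTE st].
  by rewrite !ffunE eqxx /GRing.scale/= mulr1 addr0.
by rewrite !ffunE eq_sym st /GRing.scale/= mulr0.
Qed.

Lemma reflE a x s : refl a x s = x s - 2 * bform a x * a s.
Proof. by rewrite !ffunE. Qed.

Lemma refl_linear a k x y : refl a (k *: x + y) = k *: refl a x + refl a y.
Proof.
by apply/ffunP => s; rewrite !ffunE !bformE /GRing.scale/=; ring.
Qed.

Lemma refl_id a : bform a a = 1 -> refl a a = - a.
Proof. by move=> aa; apply/ffunP => s; rewrite reflE aa ffunE; ring. Qed.

Lemma reflK a : bform a a = 1 -> involutive (refl a).
Proof.
by move=> aa x; apply/ffunP => s; rewrite !reflE /refl !bformE aa; ring.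
Qed.

Lemma bform_refl a x y :
  bform a a = 1 -> bform (refl a x) (refl a y) = bform x y.
Proof. by move=> aa; rewrite /refl !bformE aa (bformC x a); ring. Qed.

Lemma refl_perp a x : bform a x = 0 -> refl a x = x.
Proof. by move=> ax; rewrite /refl ax mulr0 scale0r subr0. Qed.

Lemma bform_simple_rootl s x : bform (simple_root s) x = \sum_t x t * c s t.
Proof.
rewrite /bform (bigD1 s)//= [X in _ + X]big1 => [|i /negbTE si]; last first.
  by apply: big1 => j _; rewrite ffunE si !mul0r.
by rewrite addr0; apply: eq_bigr => t _; rewrite ffunE eqxx mul1r.
Qed.

Lemma bform_sum x y : bform x y = \sum_s x s * bform (simple_root s) y.
Proof.
apply: eq_bigr => s _; rewrite bform_simple_rootl mulr_sumr.
by apply: eq_bigr => t _; rewrite mulrA.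
Qed.

Lemma bform_simple_root s t : bform (simple_root s) (simple_root t) = c s t.
Proof.
rewrite bform_simple_rootl (bigD1 t)//= big1 => [|j /negbTE tj].
  by rewrite ffunE eqxx mul1r addr0.
by rewrite ffunE tj mul0r.
Qed.

(** The letter in position [k], counted from the right and starting at 0, of
the alternating word that ends with [b]. The same convention is used for
products in the group and for products of reflections, and it makes [alt a b
k.+1] the letter before, as well as after, position [k]. *)
Definition alt (T : Type) (a b : T) (k : nat) : T := if odd k then a else b.

(** The value U_(k-1)(l/2) of the Chebyshev polynomials of the second kind,
with U_(-1) = 0. For l = 2 cos th it equals sin (k th) / sin th. *)
Fixpoint chebU (l : R) (k : nat) : R :=
  if k is k1.+1 then
    if k1 is k2.+1 then l * chebU l k1 - chebU l k2 else 1
  else 0.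

Lemma chebUSS l k : chebU l k.+2 = l * chebU l k.+1 - chebU l k.
Proof. by []. Qed.

Fixpoint alt_refl (a b : E) (k : nat) (x : E) : E :=
  if k is k1.+1 then refl (alt a b k1) (alt_refl a b k1 x) else x.

(** All that is needed about the dihedral group generated by two reflections,
of finite or infinite order: its orbit of [a] is computed in the plane of [a]
and [b], each further reflection shifting the Chebyshev coefficients by one. *)
Lemma alt_reflE a b k : bform a a = 1 -> bform b b = 1 ->
  let l := - (2 * bform a b) in
  alt_refl a b k a =
    chebU l k.+1 *: alt a b k.+1 + chebU l k *: alt a b k.
Proof.
move=> aa bb l; elim: k => [|k IHk] /=.
  by rewrite scale1r scale0r addr0.
rewrite IHk -chebUSS.
have nn : alt a b k.+2 = alt a b k by rewrite /alt /= negbK.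
have kk : bform (alt a b k) (alt a b k) = 1 by rewrite /alt; case: odd.
have kk1 : bform (alt a b k) (alt a b k.+1) = bform a b.
  by rewrite /alt /=; case: odd => //=; rewrite bformC.
rewrite nn; apply/ffunP => s.
rewrite reflE !bformE kk kk1 chebUSS !ffunE /GRing.scale/= -/l.
by rewrite /l; ring.
Qed.

Lemma alt_refl_double a b n x :
  alt_refl a b n.*2 x = iter n (refl a \o refl b) x.
Proof.
elim: n => //= n <-; rewrite /alt /= odd_double /=.
by [].
Qed.

End BilinearForm.

(** * Chebyshev coefficients and the braid relations *)

Section Trigonometry.
Variable R : realType.
Implicit Types (th : R) (k m : nat).

Lemma chebU_sin th k : chebU (2 * cos th) k * sin th = sin (k%:R * th).
Proof.
elim/ltn_ind: k => -[|[|k]] IH; first by rewrite /= !mul0r sin0.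
  by rewrite /= !mul1r.
have e1 : k.+2%:R * th = k.+1%:R * th + th by rewrite -[in LHS]natr1; ring.
have e0 : k%:R * th = k.+1%:R * th - th by rewrite -[in RHS]natr1; ring.
rewrite chebUSS mulrBl -mulrA (IH k)// (IH k.+1)// e0 sinB e1 sinD.
ring.
Qed.

(** The limit case th = 0, which corresponds to m(s, t) infinite. *)
Lemma chebU2 k : chebU (2 : R) k = k%:R.
Proof.
elim/ltn_ind: k => -[|[|k]] IH //.
rewrite chebUSS (IH k)// (IH k.+1)// -[in RHS]natr1 -!natr1; ring.
Qed.

Lemma pi_div_itv m : (1 < m)%N -> 0 < (pi / m%:R : R) < pi.
Proof.
move=> m1; have m0 : (0 : R) < m%:R by rewrite ltr0n ltnW.
rewrite divr_gt0 ?pi_gt0//= ltr_pdivrMr// -[ltLHS]mulr1 ltr_pM2l ?pi_gt0//.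
by rewrite ltr1n.
Qed.

Lemma sin_pi_div_gt0 m : (1 < m)%N -> 0 < sin (pi / m%:R : R).
Proof. by move=> m1; apply: sin_gt0_pi; apply: pi_div_itv. Qed.

(** The angles k pi / m, for k at most m, do not exceed pi. *)
Lemma chebU_pi_div_ge0 m k : (1 < m)%N -> (k <= m)%N ->
  0 <= chebU (2 * cos (pi / m%:R : R)) k.
Proof.
move=> m1 km; rewrite -(pmulr_lge0 _ (sin_pi_div_gt0 m1)) chebU_sin.
have m0 : (0 : R) < m%:R by rewrite ltr0n ltnW.
apply: sin_ge0_pi; rewrite mulr_ge0 ?divr_ge0 ?pi_ge0//=.
by rewrite mulrCA ler_piMr ?pi_ge0// ler_pdivrMr// mul1r ler_nat.
Qed.

Lemma chebU_pi_div_period m : (1 < m)%N ->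
  chebU (2 * cos (pi / m%:R : R)) m.*2 = 0 /\
  chebU (2 * cos (pi / m%:R : R)) m.*2.+1 = 1.
Proof.
move=> m1; have s0 := sin_pi_div_gt0 m1; have s0' := lt0r_neq0 s0.
have m0 : (m%:R : R) != 0 by rewrite pnatr_eq0 -lt0n ltnW.
have e : m.*2%:R * (pi / m%:R) = pi *+ 2 :> R.
  by rewrite -muln2 natrM -mulr_natr; field.
split; apply: (mulIf s0'); rewrite chebU_sin.
  by rewrite e sin2pi mul0r.
by rewrite -natr1 mulrDl !mul1r e addrC sinD sin2pi cos2pi; ring.
Qed.

Lemma cos_pi_div_eq0 m : (1 < m)%N -> cos (pi / m%:R : R) = 0 -> m = 2%N.
Proof.
move=> m1 c0; apply/eqP; rewrite eqn_leq m1 andbT leqNgt; apply/negP => m2.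
have m0 : (0 : R) < m%:R by rewrite ltr0n ltnW.
suff : 0 < cos (pi / m%:R : R) by rewrite c0 ltxx.
apply: cos_gt0_pihalf; apply/andP; split.
  apply: (@lt_trans _ _ 0); last by rewrite divr_gt0 ?pi_gt0.
  by rewrite oppr_lt0 divr_gt0 ?pi_gt0.
by rewrite ltr_pM2l ?pi_gt0// ltf_pV2 ?posrE// ltr_nat.
Qed.

End Trigonometry.

Section Braid.
Variables (R : realType) (I : finType) (c : I -> I -> R).
Hypothesis cC : forall s t, c s t = c t s.
Local Notation E := {ffun I -> R^o}.

Lemma iter_refl_fixed m (a b : E) : (1 < m)%N ->
  bform c a a = 1 -> bform c b b = 1 -> bform c a b = - cos (pi / m%:R) ->
  iter m (refl c a \o refl c b) a = a.
Proof.
move=> m1 aa bb ab; rewrite -alt_refl_double alt_reflE//.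
have -> : - (2 * bform c a b) = 2 * cos (pi / m%:R) by rewrite ab; ring.
have [-> ->] := chebU_pi_div_period R m1.
by rewrite scale0r addr0 scale1r /alt /= odd_double.
Qed.

Lemma iter_linear (f : E -> E) m :
  (forall k x y, f (k *: x + y) = k *: f x + f y) ->
  forall k x y, iter m f (k *: x + y) = k *: iter m f x + iter m f y.
Proof. by move=> lf k x y; elim: m => //= m ->. Qed.

Lemma iter_cancel (T : Type) (f g : T -> T) m :
  cancel f g -> cancel (iter m f) (iter m g).
Proof.
move=> fK; elim: m => // m IH x.
by rewrite (iterSr m g) (iterS m f) fK IH.
Qed.

Lemma refl_comp_cancel (a b : E) :
  bform c a a = 1 -> bform c b b = 1 ->
  cancel (refl c a \o refl c b) (refl c b \o refl c a).
Proof. by move=> aa bb x /=; rewrite (reflK aa) (reflK bb). Qed.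

Lemma refl_comp_linear (a b : E) k x y :
  (refl c a \o refl c b) (k *: x + y) =
  k *: (refl c a \o refl c b) x + (refl c a \o refl c b) y.
Proof. by rewrite /= !refl_linear. Qed.

(** The relation (r_a r_b)^m = 1. The plane of [a] and [b] is nondegenerate
since its Gram determinant is sin^2 (pi / m), so that E is the sum of this
plane, where the Chebyshev formula gives the claim, and of its orthogonal,
which both reflections fix pointwise. *)
Lemma iter_refl_comp_id m (a b : E) : (1 < m)%N ->
  bform c a a = 1 -> bform c b b = 1 -> bform c a b = - cos (pi / m%:R) ->
  forall x, iter m (refl c a \o refl c b) x = x.
Proof.
move=> m1 aa bb ab x; set f := _ \o _.
have fa : iter m f a = a by exact: iter_refl_fixed.
have fb : iter m f b = b.
  have gb : iter m (refl c b \o refl c a) b = b.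
    by apply: iter_refl_fixed; rewrite // bformC.
  rewrite -{1}gb; apply: iter_cancel; exact: refl_comp_cancel.
set C := bform c a b in ab *.
have d0 : 1 - C ^+ 2 != 0.
  rewrite ab sqrrN -sin2cos2 expf_eq0 /=.
  by rewrite gt_eqF// sin_pi_div_gt0.
(* u *: a + v *: b is the orthogonal projection of x, by Cramer's rule *)
pose u := (bform c a x - C * bform c b x) / (1 - C ^+ 2).
pose v := (bform c b x - C * bform c a x) / (1 - C ^+ 2).
pose q := x - u *: a - v *: b.
have aq : bform c a q = 0.
  by rewrite /q !bformE// aa -/C /u /v; field.
have bq : bform c b q = 0.
  by rewrite /q !bformE// bb (bformC cC b a) -/C /u /v; field.
have fq : iter m f q = q.
  by elim: (m) => // k IHk; rewrite iterS IHk /f /= !refl_perp.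
have -> : x = u *: a + (v *: b + q) 
  by rewrite /q; apply/ffunP => s; rewrite !ffunE; ring.
have lf := refl_comp_linear a b.
by rewrite !(iter_linear _ lf) fa fb fq.
Qed.

End Braid.

(** * Length in a group generated by involutions *)

Section Length.
Local Open Scope group_scope.
Variables (I : Type) (G : groupType) (gen : I -> G).
Hypothesis genK : forall s, gen s * gen s = 1.
Hypothesis gen_word : forall w : G, exists l : seq I, w = \prod_(i <- l) gen i.

Lemma len_subproof w :
  exists n, `[< exists2 l, size l = n & w = \prod_(i <- l) gen i >].
Proof.
have [l ->] := gen_word w.
by exists (size l); apply/asboolP; exists l.
Qed.

Definition len w : nat := ex_minn (len_subproof w).

Lemma len_word w : exists2 l, size l = len w & w = \prod_(i <- l) gen i.
Proof. by rewrite /len; case: ex_minnP => n /asboolP. Qed.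

Lemma len_prod l : (len (\prod_(i <- l) gen i) <= size l)%N.
Proof.
rewrite /len; case: ex_minnP => n _; apply.
by apply/asboolP; exists l.
Qed.

Lemma len_mulr w s : (len (w * gen s) <= (len w).+1)%N.
Proof.
have [l <- {1}->] := len_word w.
have -> : (\prod_(i <- l) gen i) * gen s = \prod_(i <- rcons l s) gen i.
  by rewrite -cats1 big_cat big_seq1.
by rewrite -(size_rcons l s) len_prod.
Qed.

Lemma mulg_genK s w : w * gen s * gen s = w.
Proof. by rewrite -mulgA genK mulg1. Qed.

Lemma gen_inv s : (gen s)^-1 = gen s.
Proof. exact: mulg1_eq. Qed.

Lemma len_le_mulr w s : (len w <= (len (w * gen s)).+1)%N.
Proof. by rewrite -{1}(mulg_genK s w) len_mulr. Qed.

Lemma descent w : w <> 1 -> exists s, (len (w * gen s) < len w)%N.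
Proof.
have [l lw ew] := len_word w.
case/lastP: l lw ew => [|l s] <- ew w1; first by rewrite big_nil in ew.
exists s; rewrite size_rcons ltnS.
have -> : w * gen s = \prod_(i <- l) gen i.
  by rewrite ew -cats1 big_cat big_seq1 mulg_genK.
exact: len_prod.
Qed.

Lemma gen_ind (P : G -> Prop) :
  P 1 -> (forall s w, P w -> P (gen s * w)) -> forall w, P w.
Proof.
move=> P1 PM w; have [l ->] := gen_word w.
by elim: l => [|s l IHl]; rewrite ?big_nil ?big_cons//; apply: PM.
Qed.

Fixpoint alt_prod (s t : I) (k : nat) : G :=
  if k is k1.+1 then gen (alt s t k1) * alt_prod s t k1 else 1.

Lemma alt_prodSr s t k : alt_prod s t k.+1 = alt_prod t s k * gen t.
Proof.
elim: k => [|k IHk]; first by rewrite /= mulg1 mul1g.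
rewrite -[LHS]/(gen (alt s t k.+1) * alt_prod s t k.+1) IHk /= mulgA.
by rewrite /alt /=; case: odd.
Qed.

Lemma alt_prod_double s t m : alt_prod s t m.*2 = (gen s * gen t) ^+ m.
Proof.
elim: m => // m IHm; rewrite expgS -IHm doubleS /= /alt /= odd_double /=.
by rewrite mulgA.
Qed.

(** The inverse of an alternating word is the alternating word read backwards;
the parity condition says that the two words fit together. *)
Lemma alt_prod_split s t k j : ~~ odd (k + j) ->
  (alt_prod t s j)^-1 * alt_prod s t k = alt_prod s t (k + j).
Proof.
elim: j k => [|j IHj] k kj; first by rewrite invg1 mul1g addn0.
rewrite -addSnnS -IHj ?addSnnS// -[alt_prod t s j.+1]/(_ * _) invgM gen_inv.
rewrite -mulgA; congr (_ * (gen _ * _)).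
move: kj; rewrite /alt addnS /= oddD.
by case: odd => //; case: odd.
Qed.

Lemma braid s t m : (gen s * gen t) ^+ m = 1 -> alt_prod s t m = alt_prod t s m.
Proof.
move=> stm; have : (alt_prod t s m)^-1 * alt_prod s t m = 1.
  by rewrite alt_prod_split addnn ?odd_double// alt_prod_double.
by move/mulg1_eq; rewrite invgK => <-.
Qed.

Lemma len_mul_alt v s t k : (len (v * alt_prod s t k) <= len v + k)%N.
Proof.
elim: k v => [|k IHk] v; first by rewrite mulg1 addn0.
rewrite /= mulgA (leq_trans (IHk _))// addnS -addSn leq_add2r.
exact: len_mulr.
Qed.

(** The reduction to rank 2 in the proof of Tits' theorem: strip from the right
end of [w] the longest alternating suffix in [s] and [t] that ends with [t] and
is length-additive. By maximality neither [s] nor [t] shortens what remains.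
The suffix is shorter than any positive [m] with (st)^m = 1, because by the
braid relation a suffix of length [m] could be replaced by one that ends with
[s], and [s] does not shorten [w]. *)
Lemma len_split_alt w s t : (len w <= len (w * gen s))%N ->
  (len (w * gen t) < len w)%N ->
  exists v k, [/\ w = v * alt_prod s t k, (len v < len w)%N,
    (len v <= len (v * gen (alt s t k)))%N,
    (len v <= len (v * gen (alt s t k.+1)))%N
    & forall m, (gen s * gen t) ^+ m = 1 -> (0 < m)%N -> (k < m)%N].
Proof.
move=> ws wt; pose v k := w * (alt_prod s t k)^-1.
have vE k : v k * alt_prod s t k = w by rewrite mulgVK.
have vS k : v k.+1 = v k * gen (alt s t k).
  by rewrite /v /= invgM mulgA gen_inv.
pose P k := (len (v k) + k <= len w)%N.
have PS k : P k.+1 -> P k.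
  rewrite /P vS => Pk1; apply: leq_trans Pk1.
  by rewrite addnS -addSn leq_add2r len_le_mulr.
have Ple j k : (j <= k)%N -> P k -> P j.
  by move/subnKC <-; elim: (k - j)%N => [|i IHi]; rewrite ?addn0// addnS => /PS.
have P1 : P 1%N by rewrite /P addn1 vS /v invg1 mulg1.
have Pbound k : P k -> (k <= len w)%N by apply: leq_trans; rewrite leq_addl.
case: (ex_maxnP (ex_intro P 1%N P1) Pbound) => k Pk kmax.
have k0 : (0 < k)%N by apply: kmax.
exists (v k), k; split => //.
- by apply: leq_trans Pk; rewrite -addn1 leq_add2l.
- rewrite -vS leqNgt; apply/negP => lt; suff /kmax : P k.+1 by rewrite ltnn.
  by apply: leq_trans Pk; rewrite addnS -addSn leq_add2r.
- (* the first letter of the stripped suffix, which leads back to v k.-1 *)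
  have -> : alt s t k.+1 = alt s t k.-1.
    by rewrite -[in LHS](prednK k0) /alt /= negbK.
  rewrite -{2}(prednK k0) vS mulg_genK -(leq_add2r k).
  apply: leq_trans Pk _; rewrite -{1}(vE k.-1).
  by apply: leq_trans (len_mul_alt _ _ _ _) _; rewrite leq_add2l leq_pred.
- move=> m stm m0; rewrite ltnNge; apply/negP => mk.
  have Pm := Ple _ _ mk Pk.
  have : (len (w * gen s) < len w)%N.
    apply: leq_trans Pm.
    rewrite -(vE m) (braid stm) -(prednK m0) alt_prodSr mulgA mulg_genK addnS.
    exact: len_mul_alt.
  by rewrite ltnNge ws.
Qed.

End Length.

Section LengthFinite.
Variables (I : finType) (G : groupType) (gen : I -> G).
Hypothesis gen_word :
  forall w : G, exists l : seq I, w = (\prod_(i <- l) gen i)%g.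

Lemma len_bounded_finite N :
  (forall w, (len gen_word w <= N)%N) -> finite_set [set: G].
Proof.
move=> lenN.
apply: (@sub_finite_set _ _
  [set (\prod_(i <- val l) gen i)%g | l in [set: {bseq N of I}]]).
  move=> w _ /=; have [l lw ->] := len_word gen_word w.
  have lN : (size l <= N)%N by rewrite lw lenN.
  by exists (Bseq lN).
exact/finite_image/finite_finset.
Qed.

End LengthFinite.

(** * Hyperbolic products of two reflections *)

Section Hyperbolic.
Variables (R : realType) (I : finType) (c : I -> I -> R).
Hypothesis cC : forall s t, c s t = c t s.
Local Notation E := {ffun I -> R^o}.
Local Notation B := (bform c).
Local Notation r := (refl c).

Definition in_plane (a b x : E) := exists u v : R, x = u *: a + v *: b.

Lemma in_planeD a b x y :
  in_plane a b x -> in_plane a b y -> in_plane a b (x + y).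
Proof.
move=> [u [v ->]] [u' [v' ->]]; exists (u + u'), (v + v').
by rewrite !scalerDl addrACA.
Qed.

Lemma in_planeZ a b k x : in_plane a b x -> in_plane a b (k *: x).
Proof.
by move=> [u [v ->]]; exists (k * u), (k * v); rewrite scalerDr !scalerA.
Qed.

Lemma in_plane_refl_comp a b a' b' n x :
  in_plane a b a' -> in_plane a b b' ->
  in_plane a b (iter n (r a' \o r b') x - x).
Proof.
move=> aP bP; elim: n => [|n IHn].
  by rewrite subrr; exists 0, 0; rewrite !scale0r addr0.
set y := iter n _ x in IHn *; set k := 2 * B b' y.
pose l := 2 * B a' (r b' y).
have -> : iter n.+1 (r a' \o r b') x - x =
    (y - x) + (- l *: a' + - k *: b').
  rewrite iterS -/y /= {1}/refl -/l {1}/refl -/k; apply/ffunP => s.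
  by rewrite !ffunE /GRing.scale/=; ring.
by apply: in_planeD => //; apply: in_planeD; apply: in_planeZ.
Qed.

Lemma in_planel a b : in_plane a b a.
Proof. by exists 1, 0; rewrite scale1r scale0r addr0. Qed.

Lemma in_planer a b : in_plane a b b.
Proof. by exists 0, 1; rewrite scale1r scale0r add0r. Qed.

(** Cayley-Hamilton for r_a r_b on the plane of [a] and [b], where it has
determinant 1 and trace 4 B(a, b)^2 - 2; r_b r_a is its inverse. *)
Lemma refl_comp_trace a b : B a a = 1 ->
  r a (r b a) + r b (r a a) = (4 * B a b ^+ 2 - 2) *: a.
Proof.
move=> aa; rewrite (refl_id aa); apply/ffunP => s.
rewrite /refl !bformE// aa (bformC cC b a) !ffunE /GRing.scale/=; ring.
Qed.

(** The trace of h^n, for [h] of determinant 1 and trace [l] on a plane. *)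
Fixpoint trace_seq (l : R) (n : nat) : R :=
  if n is n1.+1 then
    if n1 is n2.+1 then l * trace_seq l n1 - trace_seq l n2 else l
  else 2.

Lemma trace_seq_gt2 l n : 2 < l -> (0 < n)%N -> 2 < trace_seq l n.
Proof.
move=> l2; suff H k : 2 < trace_seq l k.+1 /\ trace_seq l k < trace_seq l k.+1.
  by case: n => // n _; have [] := H n.
elim: k => [|k [t2 tk]]; first by rewrite /=.
have -> : trace_seq l k.+2 = l * trace_seq l k.+1 - trace_seq l k by [].
have : 0 < (l - 2) * trace_seq l k.+1 by apply: mulr_gt0; lra.
by move=> ?; split; lra.
Qed.

Lemma linear_ffunD (f : E -> E) :
  (forall k x y, f (k *: x + y) = k *: f x + f y) -> {morph f : x y / x + y}.
Proof. by move=> lf x y; rewrite -[x in LHS]scale1r lf scale1r. Qed.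

Lemma linear_ffunZ (f : E -> E) :
  (forall k x y, f (k *: x + y) = k *: f x + f y) ->
  forall k, {morph f : x / k *: x}.
Proof.
move=> lf k x; rewrite -[k *: x]addr0 lf.
suff -> : f 0 = 0 by rewrite addr0.
by apply: (addrI (f 0)); rewrite -(linear_ffunD lf) !addr0.
Qed.

Lemma refl_comp_quadratic a b : B a a = 1 -> B b b = 1 ->
  let f := r a \o r b in let f' := r b \o r a in
  let l := 4 * B a b ^+ 2 - 2 in
  f (f a) = l *: f a - a /\ f' (f' a) = l *: f' a - a.
Proof.
move=> aa bb f f' l.
have tr : f a + f' a = l *: a by exact: refl_comp_trace.
have lf := refl_comp_linear c a b; have lf' := refl_comp_linear c b a.
rewrite -(linear_ffunZ lf) -(linear_ffunZ lf') -tr.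
rewrite (linear_ffunD lf) (linear_ffunD lf').
by rewrite (refl_comp_cancel bb aa) (refl_comp_cancel aa bb) addrK addrC addKr.
Qed.

Lemma iter_quadratic (f : E -> E) l a n :
  (forall k x y, f (k *: x + y) = k *: f x + f y) ->
  f (f a) = l *: f a - a -> iter n.+2 f a = l *: iter n.+1 f a - iter n f a.
Proof.
move=> lf ffa; rewrite 2!iterSr ffa (iter_linear _ lf) -iterSr -scaleN1r.
by rewrite (linear_ffunZ (iter_linear _ lf)) scaleN1r.
Qed.

Lemma iter_trace a b n : B a a = 1 -> B b b = 1 ->
  iter n (r a \o r b) a + iter n (r b \o r a) a =
  trace_seq (4 * B a b ^+ 2 - 2) n *: a.
Proof.
move=> aa bb; set f := _ \o _; set f' := r b \o _; set l := _ - 2.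
have tr : f a + f' a = l *: a by exact: refl_comp_trace.
have lf := refl_comp_linear c a b; have lf' := refl_comp_linear c b a.
have [ffa ffa'] := refl_comp_quadratic aa bb; rewrite -/f -/f' -/l in ffa ffa'.
rewrite -/f in lf; rewrite -/f' in lf'.
clearbody f f' l; elim/ltn_ind: n => -[|[|n]] IH.
  by rewrite -mulr2n -scaler_nat.
  exact: tr.
rewrite (iter_quadratic _ lf ffa) (iter_quadratic _ lf' ffa').
rewrite -[trace_seq l n.+2]/(l * trace_seq l n.+1 - trace_seq l n).
rewrite scalerBl -scalerA -(IH n)// -(IH n.+1)// scalerDr opprD.
by rewrite addrACA.
Qed.

(** The differences |u (n+1)| - |u n| increase at least by (l - 2) |u 0| at
each step, so that |u n| grows beyond any bound. *)
Lemma recurrence_escape (l : R) (u : nat -> R) : 2 < l ->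
  (forall n, u n.+2 = l * u n.+1 - u n) ->
  0 < `|u 0| -> `|u 0| <= `|u 1| -> exists n, 1 < `|u n|.
Proof.
move=> l2 uS u0 u01; pose d := (l - 2) * `|u 0%N|.
have d0 : 0 < d by apply: mulr_gt0 => //; lra.
have H n : `|u 0%N| <= `|u n| /\ `|u n| + d *+ n <= `|u n.+1|.
  elim: n => [|n [IH1 IH2]]; first by rewrite mulr0n addr0.
  have un : `|u n| <= `|u n.+1|.
    by apply: le_trans IH2; rewrite lerDl mulrn_wge0// ltW.
  split; first exact: le_trans un.
  have t : l * `|u n.+1| <= `|u n.+2| + `|u n|.
    have -> : l * `|u n.+1| = `|l * u n.+1|.
      by rewrite normrM (gtr0_norm (lt_trans _ l2)).
    by rewrite -[l * u n.+1](subrK (u n)) -uS ler_normD.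
  have : d <= (l - 2) * `|u n.+1|.
    by apply: ler_wpM2l; [lra|exact: le_trans un].
  by rewrite mulrSr; lra.
pose n := Num.truncn d^-1.
exists n.+2; have [_] := H n.+1; apply: lt_le_trans.
have : 1 < d *+ n.+1.
  rewrite -mulr_natr -ltr_pdivrMl// mulr1.
  exact: truncnS_gt.
by move=> /lt_le_trans; apply; rewrite lerDr.
Qed.

(** With h = r_a r_b, the two-sided sequence n |-> B(a, h^n d) = B(h^-n a, d)
satisfies u (n+1) + u (n-1) = l u n with l > 2. Hence |u 1| or |u (-1)| is at
least |u 0|, and the sequence escapes in that direction. *)
Lemma orbit_escape a b d : B a a = 1 -> B b b = 1 -> 1 < `|B a b| ->
  B a d != 0 -> exists n,
    1 < `|B a (iter n (r a \o r b) d)| \/ 1 < `|B a (iter n (r b \o r a) d)|.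
Proof.
move=> aa bb ab ad; set f := _ \o _; set f' := r b \o _.
have lf := refl_comp_linear c a b; have lf' := refl_comp_linear c b a.
set l := 4 * B a b ^+ 2 - 2.
have l2 : 2 < l.
  have : 1 < `|B a b| ^+ 2 by rewrite expr_gt1 // ltW.
  by rewrite /l real_normK ?num_real// => ?; lra.
have tr : f a + f' a = l *: a by exact: refl_comp_trace.
have ff' : cancel f' f by exact: refl_comp_cancel.
have f'f : cancel f f' by exact: refl_comp_cancel.
have [ffa ffa'] := refl_comp_quadratic aa bb; rewrite -/f -/f' -/l in ffa ffa'.
have isof x y : B (f x) (f y) = B x y by rewrite /f /= !bform_refl.
have isof' x y : B (f' x) (f' y) = B x y by rewrite /f' /= !bform_refl.
have adj n x : B x (iter n f d) = B (iter n f' x) d.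
  elim: n x => // n IH x.
  by rewrite (iterS n f) (iterSr n f') -IH -(isof' _ (f _)) f'f.
have adj' n x : B x (iter n f' d) = B (iter n f x) d.
  elim: n x => // n IH x.
  by rewrite (iterS n f') (iterSr n f) -IH -(isof _ (f' _)) ff'.
have uS n : B a (iter n.+2 f d) = l * B a (iter n.+1 f d) - B a (iter n f d).
  by rewrite !adj (iter_quadratic _ lf' ffa') !bformE.
have uS' n :
    B a (iter n.+2 f' d) = l * B a (iter n.+1 f' d) - B a (iter n f' d).
  by rewrite !adj' (iter_quadratic _ lf ffa) !bformE.
have ad0 : 0 < `|B a d| by rewrite normr_gt0.
have : `|B a d| <= `|B a (f d)| \/ `|B a d| <= `|B a (f' d)|.
  have e : l * B a d = B a (f d) + B a (f' d).
    by rewrite (adj 1%N) (adj' 1%N) -bformDl// addrC [f a + _]tr bformZl.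
  have : l * `|B a d| <= `|B a (f d)| + `|B a (f' d)|.
    apply: le_trans (ler_normD _ _).
    by rewrite -e normrM (gtr0_norm (lt_trans _ l2)).
  have : 0 < (l - 2) * `|B a d| by apply: mulr_gt0 => //; lra.
  by move=> ? ?; case: (lerP `|B a d| `|B a (f d)|) => ?; [left|right; lra].
case=> ge1.
  by have [n un] := recurrence_escape l2 uS ad0 ge1; exists n; left.
by have [n un] := recurrence_escape l2 uS' ad0 ge1; exists n; right.
Qed.

End Hyperbolic.

(** * The reflection representation and Tits' positivity theorem *)

Section ReflectionRepresentation.
Variables (R : realType) (I : finType) (c : I -> I -> R).
Variables (G : groupType) (gen : I -> G).
Local Notation E := {ffun I -> R^o}.
Variable act : G -> E -> E.
Local Notation B := (bform c).
Local Notation r := (refl c).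
Local Notation e := (simple_root R).

Hypothesis cC : forall s t, c s t = c t s.
Hypothesis c1 : forall s, c s s = 1.
Hypothesis c_braid : forall s t, s != t -> c s t = -1 \/
  exists m, [/\ (1 < m)%N, ((gen s * gen t) ^+ m = 1)%g &
    c s t = - cos (pi / m%:R)].
Hypothesis genK : forall s, (gen s * gen s = 1)%g.
Hypothesis gen_word :
  forall w : G, exists l : seq I, w = (\prod_(i <- l) gen i)%g.
Hypothesis act1 : forall x, act 1%g x = x.
Hypothesis actM : forall u w x, act (u * w)%g x = act u (act w x).
Hypothesis act_gen : forall s x, act (gen s) x = r (e s) x.

Local Notation l := (len gen_word).

Lemma simple_root_norm s : B (e s) (e s) = 1.
Proof. by rewrite bform_simple_root. Qed.

Lemma act_linear w k x y : act w (k *: x + y) = k *: act w x + act w y.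
Proof.
elim/(gen_ind gen_word): w => [|s w IHw]; first by rewrite !act1.
by rewrite !actM IHw !act_gen refl_linear.
Qed.

Lemma actD w x y : act w (x + y) = act w x + act w y.
Proof. exact: linear_ffunD (act_linear w) _ _. Qed.

Lemma actZ w k x : act w (k *: x) = k *: act w x.
Proof. exact: linear_ffunZ (act_linear w) _ _. Qed.

Lemma actN w x : act w (- x) = - act w x.
Proof. by rewrite -scaleN1r actZ scaleN1r. Qed.

Lemma act_sum w (x : E) : act w x = \sum_s x s *: act w (e s).
Proof.
have act0 : act w 0 = 0 by have := actZ w 0 0; rewrite !scale0r.
rewrite [in LHS](simple_root_sum x) (big_morph _ (actD w) act0).
by apply: eq_bigr => s _; rewrite actZ.
Qed.

Lemma act_isometry w x y : B (act w x) (act w y) = B x y.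
Proof.
elim/(gen_ind gen_word): w => [|s w IHw]; first by rewrite !act1.
by rewrite !actM !act_gen bform_refl// simple_root_norm.
Qed.

Lemma actK w : cancel (act w) (act w^-1%g).
Proof. by move=> x; rewrite -actM mulVg act1. Qed.

Lemma actVK w : cancel (act w^-1%g) (act w).
Proof. by move=> x; rewrite -actM mulgV act1. Qed.

Lemma act_iter w n x : act (w ^+ n)%g x = iter n (act w) x.
Proof. by elim: n => [|n IHn]; rewrite ?act1// expgS actM IHn. Qed.

Lemma act_alt s t k x :
  act (alt_prod gen s t k) x = alt_refl c (e s) (e t) k x.
Proof.
elim: k => [|k IHk]; first exact: act1.
by rewrite /= actM IHk act_gen /alt; case: odd.
Qed.

Definition nonneg (x : E) := forall s, 0 <= x s.

Lemma simple_root_nonneg s : nonneg (e s).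
Proof. by move=> t; rewrite ffunE ler0n. Qed.

Lemma chebU_coef_ge0 s t k : s != t ->
  (forall m, (gen s * gen t) ^+ m = 1 -> (0 < m)%N -> (k < m)%N)%g ->
  0 <= chebU (- (2 * c s t)) k /\ 0 <= chebU (- (2 * c s t)) k.+1.
Proof.
move=> st km; have [->|[m [m1 stm ->]]] := c_braid st.
  have -> : - (2 * -1) = 2 :> R by ring.
  by rewrite !chebU2 !ler0n.
have {}km : (k < m)%N by apply: km => //; apply: ltnW.
have -> : - (2 * - cos (pi / m%:R)) = 2 * cos (pi / m%:R) :> R by ring.
by rewrite !chebU_pi_div_ge0// ltnW.
Qed.

(** Tits' theorem, by induction on the length of [w]. The suffix stripped by
[len_split_alt] sends [e s] to a combination of [e s] and [e t] whose Chebyshev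
coefficients are nonnegative, the suffix being shorter than m(s, t); the
induction hypothesis applies to the remaining factor with both [s] and [t]. *)
Theorem act_simple_root_nonneg w s :
  (l w <= l (w * gen s)%g)%N -> nonneg (act w (e s)).
Proof.
have [n] := ubnP (l w); elim: n w s => // n IHn w s /ltnSE lwn ws.
have [->|w1] := pselect (w = 1%g).
  by rewrite act1; apply: simple_root_nonneg.
have [t wt] := descent genK gen_word w1.
have st : s != t by apply: contraTneq wt => <-; rewrite -leqNgt.
have [v [k [wE vw vx vy km]]] := len_split_alt genK ws wt.
have vn : (l v < n)%N by apply: leq_trans lwn.
have [p0 p1] := chebU_coef_ge0 st km.
rewrite wE actM act_alt alt_reflE ?simple_root_norm//.
rewrite bform_simple_root actD !actZ => i.
have alt_root j : alt (e s) (e t) j = e (alt s t j) by rewrite /alt; case: odd.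
rewrite !ffunE !alt_root.
by apply: addr_ge0; apply: mulr_ge0 => //; apply: IHn.
Qed.

(** The generator [s] sends [e s] to its opposite, so this is the positivity
theorem for [w * gen s]. *)
Lemma act_simple_root_nonpos w s :
  (l (w * gen s)%g < l w)%N -> nonneg (- act w (e s)).
Proof.
move=> ws; have : nonneg (act (w * gen s)%g (e s)).
  by apply: act_simple_root_nonneg; rewrite mulg_genK// ltnW.
by rewrite actM act_gen refl_id ?simple_root_norm// actN.
Qed.

(** Faithfulness and discreteness at once: an element [w] other than 1 has a
descent [s], and then the coordinate at [s] of [act w (e s)] is at most 0,
whereas it is 1 for the identity. *)
Lemma act_diag_gt0 w : (forall s, 0 < act w (e s) s) -> w = 1%g.
Proof.
move=> wgt0; apply: contrapT => /(descent genK gen_word)[s].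
move=> /act_simple_root_nonpos/(_ s).
by rewrite ffunE oppr_ge0 leNgt wgt0.
Qed.

(** If [g] acts as -1, then [s] lengthens [w] exactly when it shortens [g * w];
so [l (g * w)] drops at least by 1 each time that [l w] grows by 1. *)
Lemma len_opposition g w :
  (forall x, act g x = - x) -> (l (g * w)%g + l w <= l g)%N.
Proof.
move=> gN; have [n] := ubnP (l w); elim: n w => // n IHn w /ltnSE wn.
have [->|w1] := pselect (w = 1%g).
  suff -> : l 1%g = 0%N by rewrite mulg1 addn0.
  by apply/eqP; rewrite -leqn0; have := len_prod gen_word [::]; rewrite big_nil.
have [s ws] := descent genK gen_word w1; set v := (w * gen s)%g in ws.
have wE : w = (v * gen s)%g by rewrite mulg_genK.
clearbody v; have vs : nonneg (act v (e s)).
  by apply: act_simple_root_nonneg; rewrite -wE ltnW.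
have gvs : (l (g * w)%g < l (g * v)%g)%N.
  rewrite ltnNge wE mulgA; apply/negP => gvs.
  have vs' := act_simple_root_nonneg gvs; rewrite actM gN in vs'.
  have : act v (e s) = 0.
    by apply/ffunP => i; apply/eqP; rewrite !ffunE eq_le vs andbT -oppr_ge0;
       have := vs' i; rewrite ffunE.
  move/(congr1 (fun x => B x x)); rewrite act_isometry simple_root_norm.
  by rewrite -(scale0r 0) bformZ mul0r => /eqP; rewrite oner_eq0.
apply: leq_trans (IHn v (leq_trans ws wn)).
have : (l w <= (l v).+1)%N by rewrite wE len_mulr.
move=> wv; apply: (@leq_trans (l (g * w)%g + (l v).+1)).
  by rewrite leq_add2l.
by rewrite addnS -addSn leq_add2r.
Qed.

(** If the matrices of the elements of [G] are bounded, then infinitely many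
elements would yield two distinct ones, [w] and [w'], with matrices as close as
desired, and w^-1 w' would be close to the identity, against [act_diag_gt0].
Closeness is obtained by cutting the bounded region into finitely many cells.
*)
Lemma bounded_roots_finite (C : R) :
  (forall w s t, `|act w (e s) t| <= C) -> finite_set [set: G].
Proof.
pose co w s t : R := act w (e s) t.
move=> bC; have C0 : 0 <= `|C| by [].
have {}bC w s t : `|co w s t| <= `|C|.
  by apply: le_trans (bC w s t) (ler_norm _).
(* cells of width 1/K, with K beyond the norm of w^-1 in a maximum norm *)
pose K := #|I|%:R * `|C| + 1; pose M := Num.truncn (K * (2 * `|C|)).
have K0 : 0 < K by rewrite ltr_wpDl ?mulr_ge0.
pose cell w s t := Num.truncn (K * (co w s t + `|C|)).
have cellM w s t : (cell w s t < M.+1)%N.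
  rewrite ltnS; apply: le_truncn; rewrite ler_pM2l//.
  by have := bC w s t; rewrite ler_norml => /andP[_ ?]; lra.
have cell_close w w' s t :
    cell w s t = cell w' s t -> K * `|co w' s t - co w s t| < 1.
  move=> ww'; have ge0 v : 0 <= K * (co v s t + `|C|).
    apply: mulr_ge0; first exact: ltW.
    by have := bC v s t; rewrite ler_norml => /andP[? _]; lra.
  have := truncn_itv (ge0 w); have := truncn_itv (ge0 w').
  rewrite -/(cell w s t) -/(cell w' s t) -ww'.
  move=> /andP[a1 a2] /andP[b1 b2].
  rewrite -(gtr0_norm K0) -normrM ltr_norml mulrBr.
  by rewrite -natr1 !mulrDr in a1 a2 b1 b2; apply/andP; split; lra.
pose F w : {ffun I * I -> 'I_M.+1} := [ffun p => inord (cell w p.1 p.2)].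
suff Finj : injective F.
  rewrite -(preimage_setT F); apply: finite_preimage.
    by move=> u v _ _; apply: Finj.
  exact: finite_finset.
move=> w w' Fww'; have close s t : K * `|co w' s t - co w s t| < 1.
  apply: cell_close; have /ffunP/(_ (s, t)) := Fww'.
  by rewrite !ffunE => /(congr1 val) /=; rewrite !inordK.
suff : (w^-1 * w')%g = 1%g by move/mulg1_eq; rewrite invgK.
apply: act_diag_gt0 => s; rewrite actM.
rewrite -[act w' (e s)](subrK (act w (e s))) actD actK.
rewrite ffunE [e s s]ffunE eqxx act_sum sum_ffunE.
set sm := \sum_(i | _) _; rewrite -[true%:R]/(1 : R).
suff : `|sm| < 1 by rewrite ltr_norml => /andP[? _]; rewrite -ltrBlDr sub0r.
rewrite -(ltr_pM2l K0) mulr1.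
apply: (@le_lt_trans _ _ (#|I|%:R * `|C|)); last first.
  by rewrite /K ltrDl.
have -> : #|I|%:R * `|C| = \sum_(i : I) `|C| by rewrite sumr_const mulr_natl.
rewrite -{1}(gtr0_norm K0) -normrM /sm mulr_sumr.
apply: (le_trans (ler_norm_sum _ _ _)); apply: ler_sum => i _.
rewrite !ffunE /GRing.scale/= mulrA normrM -[leRHS]mul1r ler_pM//.
  by rewrite normrM (gtr0_norm K0) ltW// close.
exact: bC.
Qed.

(** * The roots are unbounded *)

Hypothesis nondeg : forall x, (forall y, B x y = 0) -> x = 0.

(** By nondegeneracy the Gram matrix is invertible; its inverse recovers the
coordinates of [x] from the numbers B(e_s, x). *)
Lemma coord_bound : exists D : R, forall (C : R) (x : E),
  (forall s, `|B (e s) x| <= C) -> forall t, `|x t| <= D * C.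
Proof.
pose A : 'M[R]_#|I| := \matrix_(i, j) c (enum_val i) (enum_val j).
pose row_of (x : E) : 'rV[R]_#|I| := \row_i x (enum_val i).
have AE x j : (row_of x *m A) 0 j = B (e (enum_val j)) x.
  rewrite mxE bform_simple_rootl (reindex (@enum_val I I)) /=.
    by apply: eq_bigr => i _; rewrite !mxE cC.
  by exists enum_rank => i _; rewrite ?enum_valK ?enum_rankK.
have Au : A \in unitmx.
  rewrite -row_free_unit; apply: inj_row_free => v vA.
  pose x : E := [ffun s => v 0 (enum_rank s)].
  have vx : v = row_of x by apply/rowP => i; rewrite mxE ffunE enum_valK.
  have x0 : x = 0.
    apply: nondeg => y; rewrite bformC// bform_sum big1// => s _.
    by rewrite -[s]enum_rankK -AE -vx vA mxE mulr0.
  by rewrite vx x0; apply/rowP => i; rewrite !mxE ffunE.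
exists (\sum_j \sum_i `|invmx A j i|) => C x xC t.
have -> : x t = row_of x 0 (enum_rank t) by rewrite mxE enum_rankK.
rewrite -(mulmxK Au (row_of x)) mxE mulr_suml.
apply: (le_trans (ler_norm_sum _ _ _)); apply: ler_sum => j _.
rewrite AE normrM mulrC; apply: ler_pM => //.
rewrite (bigD1 (enum_rank t))//= lerDl; exact: sumr_ge0.
Qed.

Definition is_root (x : E) := exists w s, x = act w (e s).

Lemma root_norm x : is_root x -> B x x = 1.
Proof. by move=> [w [s ->]]; rewrite act_isometry simple_root_norm. Qed.

Lemma simple_root_is_root s : is_root (e s).
Proof. by exists 1%g, s; rewrite act1. Qed.

(** The reflection of the root w e_s is w s w^-1. *)
Lemma root_reflection a : is_root a -> exists h, forall x, act h x = r a x.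
Proof.
move=> ra; have [w [s aE]] := ra; exists (w * gen s * w^-1)%g => x.
rewrite !actM act_gen /refl actD actN actZ actVK -aE.
by rewrite -{1}(actK w (e s)) act_isometry -aE.
Qed.

Lemma root_act w a : is_root a -> is_root (act w a).
Proof. by move=> [v [s ->]]; exists (w * v)%g, s; rewrite actM. Qed.

Lemma root_refl a b : is_root a -> is_root b -> is_root (r a b).
Proof. by move=> /root_reflection[h hE] rb; rewrite -hE; apply: root_act. Qed.

Hypothesis G_infinite : infinite_set [set: G].
Hypothesis irreducible : forall A : set I, A !=set0 ->
  (forall s t, A s -> ~ A t -> c s t = 0) -> A = setT.

(** The set [A] of the [t] for which B(e_t, b) is bounded over the roots [b]
contains all the neighbours of its elements: for b' = r_u b one has B(e_t, b')
= B(e_t, b) - 2 B(e_u, b) B(e_t, e_u). If it were nonempty it would be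
everything, the coordinates of the roots would be bounded, and [G] finite. *)
Lemma roots_unbounded s (C : R) : exists2 b, is_root b & C < `|B (e s) b|.
Proof.
apply: contrapT => sC.
pose A : set I :=
  [set t | exists C : R, forall b, is_root b -> `|B (e t) b| <= C].
have As : A s.
  exists C => b rb; rewrite leNgt; apply/negP => Cb.
  by apply: sC; exists b.
have AT : A = setT.
  apply: irreducible; first by exists s.
  move=> t u [D tD] uA; apply: contrapT => /eqP tu; apply: uA.
  exists (D / `|c t u|) => b rb.
  have tu0 : 0 < `|c t u| by rewrite normr_gt0.
  rewrite ler_pdivlMr// -normrM.
  have := tD _ (root_refl (simple_root_is_root u) rb).
  have := tD _ rb.
  rewrite /refl !bformE// bform_simple_root.
  set x := B (e t) b; set y := B (e u) b.
  have -> : y * c t u = (x - (x - 2 * y * c t u)) / 2 by field.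
  rewrite normrM (@ger0_norm _ 2^-1) ?invr_ge0// => xD yD.
  rewrite ler_pdivrMr//; apply: le_trans (ler_normB _ _) _; lra.
have [D DE] : exists D : R, forall t b, is_root b -> `|B (e t) b| <= D.
  have /choice[D DE] : forall t, exists D : R, forall b,
      is_root b -> `|B (e t) b| <= D.
    by move=> t; have : A t by rewrite AT.
  exists (\sum_t `|D t|) => t b rb.
  apply: le_trans (DE t b rb) _; apply: le_trans (ler_norm _) _.
  by rewrite (bigD1 t)//= lerDl sumr_ge0.
have [K KE] := coord_bound.
apply: G_infinite; apply: (@bounded_roots_finite (K * D)) => w t u.
by apply: KE => v; apply: DE; exists w, t.
Qed.

(** * Elements with a finite conjugacy class *)

Lemma coef_sqr_le1 s t : s != t -> c s t ^+ 2 <= 1.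
Proof.
case/c_braid => [->|[m [_ _ ->]]]; first by rewrite sqrrN expr1n.
by rewrite sqrrN -[leRHS](cos2Dsin2 (pi / m%:R)) lerDl sqr_ge0.
Qed.

(** Without neighbour, [s] would be the only generator; then the roots are
multiples of [e s], and B(e_s, b) is 1 or -1. *)
Lemma neighbor s : exists2 u, u != s & c s u != 0.
Proof.
apply: contrapT => sN.
have sT : [set s] = setT.
  apply: irreducible; first by exists s.
  move=> _ t -> ts; apply: contrapT => /eqP st0; apply: sN.
  by exists t => //; apply/eqP.
have [b rb] := roots_unbounded s 1.
have bE : b = b s *: e s.
  apply/ffunP => t; have -> : t = s by have : setT t by []; rewrite -sT.
  by rewrite !ffunE eqxx /GRing.scale/= mulr1.
have := root_norm rb; rewrite bE !bformE// simple_root_norm !mulr1 => bb.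
have : `|b s| ^+ 2 = 1 by rewrite -normrX expr2 bb normr1.
by move/eqP; rewrite sqrp_eq1// => /eqP ->; rewrite ltxx.
Qed.

(** Otherwise [b] would lie in the span of [e s] and [e u], where the form is
positive semidefinite as |c s u| <= 1; the Cauchy-Schwarz inequality would give
B(e_s, b)^2 <= 1. *)
Lemma neighbor_out_of_plane s u b : u != s -> is_root b -> 1 < `|B (e s) b| ->
  ~ in_plane (e s) b (e u).
Proof.
move=> us rb sb [x [y euE]].
have y0 : y != 0.
  apply/eqP => y0; have /ffunP/(_ u) := euE.
  rewrite y0 scale0r addr0 !ffunE eqxx (negbTE us) /GRing.scale/= mulr0.
  by move/eqP; rewrite oner_eq0.
pose p := - (y^-1 * x); pose q := y^-1.
have bE : b = p *: e s + q *: e u.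
  rewrite euE scalerDr !scalerA mulVf// scale1r addrA -scalerDl.
  by rewrite /p /q addNr scale0r add0r.
have := root_norm rb.
rewrite bE !bformE// !simple_root_norm !bform_simple_root (cC u s) => bb.
move: sb; rewrite bE !bformE// !simple_root_norm !bform_simple_root.
set z := _ + _ => z1.
have z2 : 1 < z ^+ 2 by rewrite -real_normK ?num_real// expr_gt1.
have cc : 0 <= q ^+ 2 * (1 - c s u ^+ 2).
  by rewrite mulr_ge0 ?sqr_ge0// subr_ge0 coef_sqr_le1// eq_sym.
by move: bb z2 cc; rewrite /z; nra.
Qed.

(** Pigeonhole on the conjugates of [g] by the powers of [h]. *)
Lemma fc_commute_expg (g h : G) : finite_set (conjugacy_class g) ->
  exists2 n, (0 < n)%N & commute g (h ^+ n)%g.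
Proof.
move=> gfin; apply: contrapT => hN.
pose f k := (g ^ (h ^+ k))%g.
have flt i j : (i < j)%N -> f i <> f j.
  move=> ij fij; apply: hN; exists (j - i)%N; first by rewrite subn_gt0.
  apply/commgP/conjg_fixP; apply: (@conjg_inj _ (h ^+ i)%g).
  by rewrite -conjgM -expgnDr subnK ?(ltnW ij).
apply: infinite_nat; have -> : [set: nat] = f @^-1` conjugacy_class g.
  by apply/esym/seteqP; split => // k _; exists (h ^+ k)%g.
apply: finite_preimage => // i j _ _ fij.
by have [/flt|/flt|//] := ltngtP i j; rewrite fij.
Qed.

(** With h = r_a r_b and h^n commuting with [g], apply [g] to the identity h^n
a + h^-n a = T a: the vector y = g a satisfies the same identity, and (T - 2) y
= (h^n y - y) + (h^-n y - y) lies in the plane because h^n - 1 and h^-n - 1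
take their values there. *)
Lemma fc_plane g a b : finite_set (conjugacy_class g) ->
  is_root a -> is_root b -> 1 < `|B a b| -> in_plane a b (act g a).
Proof.
move=> gfc ra rb ab; have aa := root_norm ra; have bb := root_norm rb.
have [ha haE] := root_reflection ra; have [hb hbE] := root_reflection rb.
have [n n0 gn] := fc_commute_expg (ha * hb)%g gfc.
set f := r a \o r b; set f' := r b \o r a.
have fK : cancel (iter n f) (iter n f').
  by apply: iter_cancel; apply: refl_comp_cancel.
have f'K : cancel (iter n f') (iter n f).
  by apply: iter_cancel; apply: refl_comp_cancel.
have fE x : iter n f x = act ((ha * hb) ^+ n)%g x.
  by rewrite act_iter; apply: eq_iter => y; rewrite actM haE hbE.
have gf x : act g (iter n f x) = iter n f (act g x).
  by rewrite !fE -!actM gn.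
have gf' x : act g (iter n f' x) = iter n f' (act g x).
  by rewrite -{2}(f'K x) gf fK.
have := congr1 (act g) (iter_trace cC n aa bb).
rewrite actD gf gf' actZ; set T := trace_seq _ _; set y := act g a => yE.
have T2 : 2 < T.
  apply: trace_seq_gt2 => //.
  have : 1 < `|B a b| ^+ 2 by rewrite expr_gt1.
  by rewrite real_normK ?num_real// => ?; lra.
have -> : y = (T - 2)^-1 *: ((iter n f y - y) + (iter n f' y - y)).
  rewrite addrACA yE -opprD -mulr2n -[y *+ 2]scaler_nat -scalerBl scalerA.
  by rewrite mulVf ?scale1r// subr_eq0 gt_eqF.
apply: in_planeZ; apply: in_planeD; apply: in_plane_refl_comp;
  by [exact: in_planel|exact: in_planer].
Qed.

(** The root [d] is found in the orbit of the neighbour [e u] under the powers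
of r_(e_s) r_b: this product preserves the plane, so the whole orbit stays
outside, and [orbit_escape] gives a member with large product with [e s]. *)
Lemma hyperbolic_partner s b u : u != s -> c s u != 0 ->
  is_root b -> 1 < `|B (e s) b| ->
  exists d, [/\ is_root d, 1 < `|B (e s) d| & ~ in_plane (e s) b d].
Proof.
move=> us su rb sb; have bb := root_norm rb; have ss := simple_root_norm s.
have root_iter a a' n x : is_root a -> is_root a' -> is_root x ->
    is_root (iter n (r a \o r a') x).
  by move=> ra ra' rx; elim: n => //= n IHn; do 2 apply: root_refl => //.
have out a a' n : in_plane (e s) b a -> in_plane (e s) b a' ->
    ~ in_plane (e s) b (iter n (r a \o r a') (e u)).
  move=> aP a'P xP; apply: (neighbor_out_of_plane us rb sb).
  have := in_planeD xP (in_planeZ (-1) (in_plane_refl_comp c n (e u) aP a'P)).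
  by rewrite scaleN1r opprB addrC subrK.
have := simple_root_is_root.
have := in_planel (e s) b; have := in_planer (e s) b => bP sP re.
have su' : B (e s) (e u) != 0 by rewrite bform_simple_root.
have [n [su1|su1]] := orbit_escape cC ss bb sb su'.
  exists (iter n (r (e s) \o r b) (e u)).
  by split; [exact: root_iter|done|exact: out].
exists (iter n (r b \o r (e s)) (e u)).
by split; [exact: root_iter|done|exact: out].
Qed.

(** [act g (e s)] lies in two distinct planes that contain [e s], hence on the
line of [e s]; the square of the factor is 1 because [g] preserves the form. *)
Lemma fc_simple_root g s : finite_set (conjugacy_class g) ->
  exists k, [/\ act g (e s) = k *: e s & k ^+ 2 = 1].
Proof.
move=> gfc; have [u us su] := neighbor s.
have [b rb sb] := roots_unbounded s 1.
have [d [rd sd dP]] := hyperbolic_partner us su rb sb.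
have [x [y gb]] := fc_plane gfc (simple_root_is_root s) rb sb.
have [x' [y' gd]] := fc_plane gfc (simple_root_is_root s) rd sd.
have y'0 : y' = 0.
  apply: contrapT => /eqP y'0; apply: dP.
  exists (y'^-1 * (x - x')), (y'^-1 * y).
  rewrite -!scalerA -scalerDr scalerBl addrAC -gb gd addrC addKr.
  by rewrite scalerA mulVf// scale1r.
rewrite y'0 scale0r addr0 in gd.
exists x'; split => //; have := act_isometry g (e s) (e s).
by rewrite gd !bformE// simple_root_norm mulr1 expr2.
Qed.

(** The eigenvalues 1 or -1 of [g] at neighbouring simple roots agree since [g]
is an isometry, so by irreducibility [g] acts as 1 or -1. *)
Theorem fc_trivial (g : G) : finite_set (conjugacy_class g) -> g = 1%g.
Proof.
move=> gfc; have /choice[k kE] := fun s => fc_simple_root s gfc.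
have kc s t : c s t != 0 -> k s = k t.
  move=> st0; have := act_isometry g (e s) (e t).
  have [-> ks] := kE s; have [-> kt] := kE t.
  rewrite !bformE// bform_simple_root => /eqP.
  rewrite mulrA -subr_eq0 -{2}[c s t]mul1r -mulrBl mulf_eq0 (negbTE st0).
  rewrite orbF subr_eq0.
  move=> /eqP kk; rewrite -[LHS]mulr1 -kt expr2 mulrA.
  by rewrite [k s * k t]mulrC kk mul1r.
apply: act_diag_gt0 => s.
have kconst t : k t = k s.
  suff : [set t | k t = k s] t by [].
  rewrite (_ : [set _ | _] = setT)//; apply: irreducible; first by exists s.
  move=> u v /= us vs; apply: contrapT => /eqP/kc uv.
  by apply: vs; rewrite -uv.
have [gs /eqP] := kE s; rewrite sqrf_eq1 => /orP[/eqP k1|/eqP kN1].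
  by rewrite gs k1 scale1r ffunE eqxx.
exfalso; apply: G_infinite.
have gN x : act g x = - x.
  rewrite act_sum [x in RHS]simple_root_sum -sumrN; apply: eq_bigr => t _.
  by have [-> _] := kE t; rewrite kconst kN1 scaleN1r scalerN.
apply: (@len_bounded_finite _ _ _ gen_word (l g)) => w.
by apply: leq_trans (len_opposition w gN); rewrite leq_addl.
Qed.

End ReflectionRepresentation.

(** * The group of bijections of a type *)

(** The inverse is part of the data, so that it need not be chosen; it is
determined by the function ([bijection_eq]). *)
Record bijection_of (T : Type) := Bijection {
  bij_fun : T -> T;
  bij_inv : T -> T;
  bij_funK : cancel bij_fun bij_inv;
  bij_invK : cancel bij_inv bij_fun
}.

HB.instance Definition _ (T : Type) := gen_eqMixin (bijection_of T).
HB.instance Definition _ (T : Type) := gen_choiceMixin (bijection_of T).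

Lemma bijection_eq (T : Type) (f g : bijection_of T) :
  bij_fun f =1 bij_fun g -> f = g.
Proof.
case: f g => [f f' fK f'K] [g g' gK g'K] /= /funext fg; subst g.
have fg' : f' = g' by apply/funext => x; rewrite -{1}(g'K x) fK.
by subst g'; congr Bijection; apply: Prop_irrelevance.
Qed.

Section BijectionGroup.
Variable T : Type.
Implicit Types f g h : bijection_of T.

Definition bij_one : bijection_of T :=
  @Bijection T id id (fun _ => erefl) (fun _ => erefl).
Definition bij_mul f g : bijection_of T :=
  Bijection (can_comp (bij_funK f) (bij_funK g))
            (can_comp (bij_invK g) (bij_invK f)).
Definition bij_opp f : bijection_of T := Bijection (bij_invK f) (bij_funK f).

Lemma bij_mulA : associative bij_mul.
Proof. by move=> f g h; apply: bijection_eq. Qed.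
Lemma bij_mul1b : left_id bij_one bij_mul.
Proof. by move=> f; apply: bijection_eq. Qed.
Lemma bij_mulb1 : right_id bij_one bij_mul.
Proof. by move=> f; apply: bijection_eq. Qed.
Lemma bij_mulVb : left_inverse bij_one bij_opp bij_mul.
Proof. by move=> f; apply: bijection_eq => x /=; rewrite bij_funK. Qed.
Lemma bij_mulbV : right_inverse bij_one bij_opp bij_mul.
Proof. by move=> f; apply: bijection_eq => x /=; rewrite bij_invK. Qed.

HB.instance Definition _ := isGroup.Build (bijection_of T)
  bij_mulA bij_mul1b bij_mulb1 bij_mulVb bij_mulbV.

Lemma bij_funM f g x : bij_fun (f * g)%g x = bij_fun f (bij_fun g x).
Proof. by []. Qed.

Lemma bij_funX f n x : bij_fun (f ^+ n)%g x = iter n (bij_fun f) x.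
Proof. by elim: n => // n IHn; rewrite expgS bij_funM IHn. Qed.

End BijectionGroup.

(** * The reflection representation of a Coxeter system *)

Section CoxeterSystem.
Variables (G : groupType).

Lemma expg_gorder (x : G) : gorder x <> 0%N -> (x ^+ gorder x = 1)%g.
Proof.
rewrite /gorder; case: pselect => // h _.
by case: ex_minnP => n /andP[_ /eqP].
Qed.

Lemma eq_gorder (x y : G) : (forall n, (x ^+ n == 1) = (y ^+ n == 1))%g ->
  gorder x = gorder y.
Proof.
move=> xy; rewrite /gorder.
case: pselect => hx; case: pselect => hy //.
- case: ex_minnP => n; rewrite xy => yn nmin; case: ex_minnP => m ym mmin.
  by apply/eqP; rewrite eqn_leq nmin ?mmin// xy.
- by case: hy; case: hx => n; rewrite xy; exists n.
- by case: hx; case: hy => n; rewrite -xy; exists n.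
Qed.

Variable S : {fset G}.
Hypothesis hcox : coxeter_system [set` S].

Lemma coxeter_involution (s : G) : s \in S -> (s * s = 1)%g.
Proof.
case: hcox => ord2 _ _ /ord2 s2.
by have := @expg_gorder s; rewrite s2; apply.
Qed.

Lemma coxeter_inv (s : G) : s \in S -> (s^-1 = s)%g.
Proof. by move=> sS; apply: mulg1_eq; apply: coxeter_involution. Qed.

Lemma coxeter_mC (s t : G) :
  s \in S -> t \in S -> coxeter_m s t = coxeter_m t s.
Proof.
move=> sS tS; apply: eq_gorder => n.
by rewrite -invg_eq1 -expVgn invgM !coxeter_inv.
Qed.

Lemma coxeter_m_gt1 (s t : G) : s \in S -> t \in S -> s != t ->
  coxeter_m s t != 0%N -> (1 < coxeter_m s t)%N.
Proof.
move=> sS tS st m0; rewrite ltn_neqAle eq_sym lt0n m0 andbT.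
apply: contra st => /eqP m1.
have := @expg_gorder (s * t)%g; rewrite -/(coxeter_m s t) m1 expg1.
by move=> /(_ (fun h => O_S 0 (esym h)))/mulg1_eq; rewrite coxeter_inv// => ->.
Qed.

Lemma coxeter_word (w : G) : exists l : seq S, w = (\prod_(i <- l) val i)%g.
Proof.
case: hcox => _ gen _.
pose H : set G := [set w | exists l : seq S, w = (\prod_(i <- l) val i)%g].
suff HT : H = setT by have : H w by rewrite HT.
apply: gen.
  split; first by exists [::]; rewrite big_nil.
    by move=> _ _ [l ->] [l' ->]; exists (l ++ l'); rewrite big_cat.
  move=> _ [l ->]; exists (rev l); elim: l => [|i l IHl].
    by rewrite !big_nil invg1.
  rewrite big_cons invgM IHl rev_cons -cats1 big_cat big_seq1.
  by rewrite coxeter_inv// (valP i).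
by move=> s sS; exists [:: [` sS]%fset]; rewrite big_seq1.
Qed.

Variable R : realType.
Let I : finType := S.
Let c (s t : I) : R := canonical_coef R (val s) (val t).
Local Notation E := {ffun I -> R^o}.

Lemma canonical_coefC s t : c s t = c t s.
Proof.
by rewrite /c /canonical_coef eq_sym (coxeter_mC (valP s) (valP t)).
Qed.

Lemma canonical_coef1 s : c s s = 1.
Proof. by rewrite /c /canonical_coef eqxx. Qed.

Lemma canonical_coef_braid s t : s != t -> c s t = -1 \/
  exists m, [/\ (1 < m)%N, ((val s * val t) ^+ m = 1)%g &
    c s t = - cos (pi / m%:R)].
Proof.
move=> st; have vst : val s != val t by rewrite (inj_eq val_inj).
rewrite /c /canonical_coef (negbTE vst).
case: eqVneq => [_|m0]; [by left|right; exists (coxeter_m (val s) (val t))].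
split=> //; first by apply: coxeter_m_gt1; rewrite ?(valP s) ?(valP t).
by apply: expg_gorder; apply/eqP.
Qed.

(** cos (pi / m) vanishes only for m = 2, and two involutions whose product has
order 2 commute. *)
Lemma canonical_coef_commute s t : c s t = 0 -> commute (val s) (val t).
Proof.
have [<- _|st] := eqVneq s t; first exact: commute_refl.
have [->|[m [m1 stm ->]]] := canonical_coef_braid st.
  by move=> /eqP; rewrite oppr_eq0 oner_eq0.
move=> /eqP; rewrite oppr_eq0 => /eqP/(cos_pi_div_eq0 m1) m2.
rewrite m2 in stm; apply/esym.
by have := mulg1_eq stm; rewrite invgM !coxeter_inv ?(valP s) ?(valP t).
Qed.

Lemma canonical_irreducible : indecomposable [set` S] ->
  forall A : set I, A !=set0 -> (forall s t, A s -> ~ A t -> c s t = 0) ->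
  A = setT.
Proof.
move=> hind A A0 Ac; apply: contrapT => AT; apply: hind.
exists (val @` A), (val @` ~` A); split.
- rewrite -image_setU setUCr; apply/seteqP; split => [_ [s _ <-]|s sS] /=.
    exact: valP.
  by exists [` sS]%fset.
- apply/seteqP; split => // _ [[s sA <-] [t tA /val_inj ts]].
  by case: tA; rewrite ts.
- exact: image_nonempty.
- apply: image_nonempty; apply/set0P/eqP => A0'; apply: AT.
  by rewrite -[A]setCK A0' setC0.
- by move=> _ _ [s sA <-] [t tA <-]; apply: canonical_coef_commute; apply: Ac.
Qed.

(** The universal property of the presentation, applied to the map from the
generators to the group of all bijections of E; the braid relations hold there
by [iter_refl_comp_id]. *)
Lemma reflection_representation : exists act : G -> E -> E,
  [/\ forall x, act 1%g x = x,
      forall u w x, act (u * w)%g x = act u (act w x)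
    & forall s x, act (val s) x = refl c (simple_root R s) x].
Proof.
case: hcox => _ _ univ.
have sr1 s : bform c (simple_root R s) (simple_root R s) = 1.
  by rewrite bform_simple_root canonical_coef1.
pose rf (s : I) := Bijection (reflK (sr1 s)) (reflK (sr1 s)).
pose f (g : G) : bijection_of E := if insub g is Some s then rf s else 1%g.
have fE (s : I) : f (val s) = rf s by rewrite /f valK.
have [s t sS tS m0|phi phiE] := univ _ f.
  rewrite -[s]/(val [` sS]%fset) -[t]/(val [` tS]%fset) in m0 *.
  move: [` sS]%fset [` tS]%fset m0 => {sS tS}s {}t m0; rewrite !fE.
  apply: bijection_eq => x; rewrite bij_funX.
  rewrite (eq_iter (f' := refl c (simple_root R s) \o refl c (simple_root R t)))//.
  have [<-|st] := eqVneq s t.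
    by elim: coxeter_m => //= n ->; rewrite !reflK.
  apply: iter_refl_comp_id => //; first exact: canonical_coefC.
    apply: coxeter_m_gt1; rewrite ?(valP s) ?(valP t) ?(inj_eq val_inj)//.
    exact/eqP.
  rewrite bform_simple_root /c /canonical_coef (inj_eq val_inj) (negbTE st).
  by case: eqVneq m0.
exists (fun w => bij_fun (phi w)); split.
- move=> x; suff -> : phi 1%g = 1%g by [].
  by apply: (mulgI (phi 1%g)); rewrite -gmulfM !mulg1.
- by move=> u w x; rewrite gmulfM.
- by move=> s x; rewrite phiE ?fE//; apply: valP.
Qed.

End CoxeterSystem.

Theorem proposition2 (R : realType) (G : groupType) (S : {fset G})
    (hcox : coxeter_system [set` S])
    (hind : indecomposable [set` S])
    (hinf : infinite_set [set: G])
    (hindef : indefinite_form (@canonical_form R G S))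
    (hnondeg : nondegenerate_form (@canonical_form R G S)) :
  icc G.
Proof.
have [act [act1 actM act_gen]] := reflection_representation hcox R.
move=> g g1 gfin; apply: g1; move: gfin.
apply: (fc_trivial _ _ _ _ _ act1 actM act_gen).
- exact: canonical_coefC hcox R.
- exact: canonical_coef1.
- exact: canonical_coef_braid hcox R.
- by move=> s; apply: coxeter_involution hcox _ (valP s).
- exact: coxeter_word hcox.
- exact: hnondeg.
- exact: hinf.
- exact: canonical_irreducible hcox R hind.
Qed.
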